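(* Let $k$ be a non-negative integer and let $\mathfrak C$ be a hereditary class of finite ordered binary structures of type $k$, with profile $\varphi_{\mathfrak C}$. Then: (1) either $\varphi_{\mathfrak C}$ is bounded above by a polynomial, and in this case there is an integer $\ell$ such that every member of $\mathfrak C$ has a monomorphic decomposition into at most $\ell$ blocks; (2) or $\varphi_{\mathfrak C}$ is bounded below by the Fibonacci function, i.e. $\varphi_{\mathfrak C}(n)\ge F_n$ for every $n\in\mathbb N$.
   Context: An ordered binary structure of type $k$ is a structure $\mathcal R=(V,\leq,\rho_1,\dots,\rho_k)$ where $\leq$ is a linear order on the set $V$ and each $\rho_i$ is a binary relation on $V$. $\mathcal R$ embeds into $\mathcal R'$ if $\mathcal R$ is isomorphic to an induced substructure of $\mathcal R'$. A class $\mathfrak C$ of finite structures of type $k$ is hereditary if every structure embeddable into a member of $\mathfrak C$ belongs to $\mathfrak C$. The profile of $\mathfrak C$ is the function $\varphi_{\mathfrak C}$ which counts, for each non-negative integer $n$, the number $\varphi_{\mathfrak C}(n)$ of members of $\mathfrak C$ defined on $n$ elements, isomorphic structures being identified. A monomorphic decomposition of a structure $\mathcal R$ with domain $V$ is a partition $(V_j)_{j\in J}$ of $V$ such that for all finite subsets $A,A'$ of $V$, the induced structures $\mathcal R_{\restriction A}$ and $\mathcal R_{\restriction A'}$ are isomorphic whenever $|A\cap V_j|=|A'\cap V_j|$ for every $j\in J$. The Fibonacci function is $n\mapsto F_n$ with $F_0=F_1=1$ and $F_n=F_{n-1}+F_{n-2}$ for $n\ge 2$. *)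

(* Defs.v *)
From HB Require Import structures.
From mathcomp Require Import all_boot all_order all_algebra.
From mathcomp Require Import boolp.

Set Implicit Arguments.
Unset Strict Implicit.
Unset Printing Implicit Defensive.

Definition linear_order (V : Type) (r : rel V) : Prop :=
  [/\ reflexive r, antisymmetric r, transitive r & total r].

(* Relations are stored as sets of pairs so that, for fixed [k] and [V], the
   structures form a finite type and can be counted. *)
Record obstruct (k : nat) (V : finType) := OBStruct {
  obrels : {set V * V} * {ffun 'I_k -> {set V * V}};
  obrelsP : `[< linear_order (fun x y : V => (x, y) \in obrels.1) >] }.

HB.instance Definition _ (k : nat) (V : finType) :=
  [isSub for @obrels k V].
HB.instance Definition _ (k : nat) (V : finType) :=
  [Equality of obstruct k V by <:].
HB.instance Definition _ (k : nat) (V : finType) :=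
  [Choice of obstruct k V by <:].
HB.instance Definition _ (k : nat) (V : finType) :=
  [Countable of obstruct k V by <:].
HB.instance Definition _ (k : nat) (V : finType) :=
  [Finite of obstruct k V by <:].

Definition ole (k : nat) (V : finType) (R : obstruct k V) : rel V :=
  fun x y => (x, y) \in (obrels R).1.

Definition orho (k : nat) (V : finType) (R : obstruct k V) (i : 'I_k) : rel V :=
  fun x y => (x, y) \in (obrels R).2 i.

Lemma ole_linear (k : nat) (V : finType) (R : obstruct k V) :
  linear_order (ole R).
Proof. exact/asboolP/(obrelsP R). Qed.

Definition isomorphic (k : nat) (V W : finType)
    (R : obstruct k V) (S : obstruct k W) : Prop :=
  exists f : V -> W,
    [/\ bijective f,
        forall x y, ole S (f x) (f y) = ole R x y &
        forall i x y, orho S i (f x) (f y) = orho R i x y].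

Section Induced.
Variables (k : nat) (V : finType) (R : obstruct k V) (A : {set V}).

Definition induced_rels :
    {set {x | x \in A} * {x | x \in A}} *
    {ffun 'I_k -> {set {x | x \in A} * {x | x \in A}}} :=
  ([set p | ole R (val p.1) (val p.2)],
   [ffun i => [set p | orho R i (val p.1) (val p.2)]]).

Lemma induced_relsP :
  `[< linear_order (fun x y => (x, y) \in induced_rels.1) >].
Proof.
have [le_refl le_anti le_trans le_total] := ole_linear R.
apply/asboolP; split.
- by move=> x; rewrite inE.
- by move=> x y; rewrite !inE => /le_anti/val_inj.
- by move=> y x z; rewrite !inE; apply: le_trans.
- by move=> x y; rewrite !inE; apply: le_total.
Qed.

Definition induced : obstruct k {x | x \in A} := OBStruct induced_relsP.

End Induced.

Definition embeds (k : nat) (V W : finType)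
    (R : obstruct k V) (S : obstruct k W) : Prop :=
  exists A : {set W}, isomorphic R (induced S A).

Definition obclass (k : nat) := forall V : finType, obstruct k V -> Prop.

Definition hereditary (k : nat) (C : obclass k) : Prop :=
  forall (V W : finType) (R : obstruct k V) (S : obstruct k W),
    C W S -> embeds R S -> C V R.

(* The number of isomorphism classes of members of [C] with domain ['I_n].  For
   a class closed under isomorphism, in particular a hereditary one, every
   member on [n] elements has a copy on ['I_n]. *)
Definition profile (k : nat) (C : obclass k) (n : nat) : nat :=
  #|equivalence_partition
      (fun R S : obstruct k 'I_n => `[< isomorphic R S >])
      [set R : obstruct k 'I_n | `[< C 'I_n R >]]|.

Definition monomorphic_decomposition (k : nat) (V : finType)
    (R : obstruct k V) (P : {set {set V}}) : Prop :=
  partition P [set: V] /\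
  forall A A' : {set V},
    (forall B, B \in P -> #|A :&: B| = #|A' :&: B|) ->
    isomorphic (induced R A) (induced R A').

Definition polynomially_bounded (f : nat -> nat) : Prop :=
  exists p : {poly rat}, forall n : nat, ((f n)%:R <= p.[n%:R])%R.

(* Indexed so that [fib 0 = fib 1 = 1]. *)
Fixpoint fib (n : nat) : nat :=
  match n with
  | 0 => 1
  | n1.+1 => match n1 with 0 => 1 | n2.+1 => fib n1 + fib n2 end
  end.

(* Main.v *)
Require Import Defs.
From mathcomp Require Import all_boot all_order all_algebra.
From mathcomp Require Import boolp zify.

(** In a finite ordered binary structure on [N] elements, replace every element
by its rank and record, for each pair of ranks, which relations hold in either
direction.  The structure becomes a coloring [c x y] of the pairs of numbers
below [N], and since a finite linear order is rigid, isomorphism becomes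
equality of colorings.

Call [x] a break if [x] and [x.+1] are told apart either by their own colors
[c x x] and [c x.+1 x.+1], or by a third element [z], the witness, with
[c x z <> c x.+1 z].  Cutting at the breaks splits the order into intervals
such that [c x y] depends only on the blocks of [x] and [y] and on which of the
two is larger ([block_cmp]).  So if the number of breaks is bounded over the
class, each member has a monomorphic decomposition into boundedly many
intervals ([blocked_monomorphic]), and a member on [n] elements is determined by
the positions of boundedly many cuts and a bounded table of colors, whence a
polynomial bound on the profile ([profile_le_blocked]).

If the number of breaks is unbounded, fix [n] and apply Ramsey's theorem to
the triples [(x, x.+1, z)] made of a break and its witness.  In a long
homogeneous family the order and the colors between two triples depend only on
which comes first, and few configurations are left: own colors that alternate
along the order; one witness common to all pairs; witnesses that are all on the
same side of the pairs and form with them a matching or a half graph; or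
witnesses interleaved with the pairs.  Each of them contains, for each binary
word of length [n.-1] without two consecutive ones, an [n]-element
substructure, and different words yield non-isomorphic substructures
([fib_rich_of_breaks], [fib_le_profile]).  There are [fib n] such words.

In the first two configurations even all binary words can be encoded, by
choosing independently one element from each pair.  In the others bit [i]
concerns the neighbouring positions [i] and [i.+1]: it says whether the elements
at these positions are taken from the same pair, or, for the half graph, whether
their indices are exchanged.  Two consecutive bits would compete for the same
element, which is why the Fibonacci numbers appear. *)

Set Implicit Arguments.
Unset Strict Implicit.
Unset Printing Implicit Defensive.

(** * Ramsey's theorem for pairs *)

Lemma pigeonhole_class (Q : finType) (X : Type) (f : X -> Q) (M : Q -> nat)
    (L : seq X) :
  \sum_q M q < size L -> exists q, M q <= count (fun x => f x == q) L.
Proof.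
move=> hL; apply/existsP; apply: contraLR hL; rewrite negb_exists => /forallP h.
rewrite -leqNgt.
have -> : size L = \sum_q count (fun x => f x == q) L.
  elim: L {h} => [|x L IH] /=; first by rewrite big1.
  rewrite big_split /= -IH (bigD1 (f x)) //= eqxx big1 // => q /negPf.
  by rewrite eq_sym => ->.
by apply: leq_sum => q _; apply: ltnW; rewrite ltnNge.
Qed.

(** Allowing a different target size for each color makes the induction on the
sum of the targets go through: the first element [x] splits the rest according
to the color seen from [x], and in the majority class the target of that color
can be lowered by one. *)
Lemma ramsey_targets (Q : finType) (g : {ffun Q -> nat}) :
  exists M, forall (X : eqType) (chi : X -> X -> Q) (L : seq X), M <= size L ->
    exists q L', [/\ subseq L' L, size L' = g q
                   & pairwise (fun x y => chi x y == q) L'].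
Proof.
have [m] := ubnP (\sum_q g q); elim: m g => // m IH g; rewrite ltnS => hg.
have [q0 /eqP gq0|g_gt0] := pickP (fun q => g q == 0).
  by exists 0 => X chi L _; exists q0, [::]; rewrite sub0seq gq0.
pose g' q := [ffun p => if p == q then (g p).-1 else g p].
have hIH q : \sum_p g' q p < m.
  apply: leq_trans hg; rewrite (bigD1 q) //= [leqRHS](bigD1 q) //= !ffunE eqxx.
  rewrite -addSn prednK ?lt0n ?g_gt0 // leq_add2l leq_sum // => p /negPf.
  by rewrite ffunE => ->.
have [M hM] := boolp.choice (fun q => IH _ (hIH q)).
exists (\sum_q M q).+2 => X chi [//|x L] /=; rewrite ltnS => hs.
have [q] := pigeonhole_class (chi x) hs.
rewrite -size_filter => /hM-/(_ chi)[p [L' [sL' zL' pL']]].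
have sL : subseq L' L := subseq_trans sL' (filter_subseq _ _).
move: zL'; rewrite ffunE; case: eqP => [epq zL'|_ zL']; last first.
  by exists p, L'; split => //; exact: (subseq_trans sL (subseq_cons L x)).
exists p, (x :: L'); split => /=; first by rewrite eqxx.
  by rewrite zL' prednK ?lt0n ?g_gt0.
rewrite pL' andbT epq; apply/allP => y /(mem_subseq sL').
by rewrite mem_filter => /andP[].
Qed.

Lemma ramsey_pairs (Q : finType) (K : nat) :
  exists M, forall (X : eqType) (chi : X -> X -> Q) (L : seq X), M <= size L ->
    exists q L', [/\ subseq L' L, size L' = K
                   & pairwise (fun x y => chi x y == q) L'].
Proof.
have [M hM] := ramsey_targets [ffun _ : Q => K].
exists M => X chi L /(hM _ chi)[q [L' [? zL' ?]]].
by exists q, L'; split; rewrite // zL' ffunE.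
Qed.

(** * Families of substructures indexed by Fibonacci words *)

Definition sparse (b : nat -> bool) := forall i, ~~ (b i && b i.+1).

(** Each sparse [b] selects elements [t b 0, .., t b n.-1] of the coloring, not
necessarily in increasing order.  Since [sigma] does not depend on [b], two
selections that induce isomorphic structures must correspond position by
position; the last clause then separates distinct words.  It only looks at the
first index [i] where they differ, so that the elements chosen up to position
[i] follow from a common prefix. *)
Definition fib_rich (T : Type) (c : nat -> nat -> T) (N n : nat) : Prop :=
  exists (t : (nat -> bool) -> nat -> nat) (sigma : nat -> nat -> bool),
  [/\ forall b i, sparse b -> i < n -> t b i < N,
      forall b i j, sparse b -> i < j -> j < n ->
        if sigma i j then t b i < t b j else t b j < t b i
    & forall b b' i, sparse b -> sparse b' -> i.+1 < n ->
        (forall j, j < i -> b j = b' j) -> b i -> ~~ b' i ->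
        exists j j', [/\ j < n, j' < n & c (t b j) (t b j') <> c (t b' j) (t b' j')]].

Section Configurations.

Variables (T : Type) (c : nat -> nat -> T) (N n : nat).

Lemma fib_rich_diagonal (x : nat -> nat) :
  (forall i, i < n -> (x i).+1 < N) ->
  (forall i j, i < j -> j < n -> (x i).+1 < x j) ->
  (forall i, i < n -> c (x i) (x i) <> c (x i).+1 (x i).+1) ->
  fib_rich c N n.
Proof.
move=> xN xx cx; exists (fun b i => x i + b i), (fun _ _ => true); split.
- by move=> b i _ /xN; case: (b i); lia.
- by move=> b i j _ ij /(xx _ _ ij); case: (b i); lia.
- move=> b b' i _ _ lin _ bi /negPf b'i; have ltin : i < n by lia.
  by exists i, i; split; rewrite // bi b'i addn1 addn0; apply/nesym/cx.
Qed.

(** The vertex [z] serves as a probe at the last position; every binary word can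
be read in the colors seen from it. *)
Lemma fib_rich_star (w : nat -> bool -> nat) (z : nat) (s : bool) :
  z < N -> (forall i e, i < n -> w i e < N) ->
  (forall i j e e', i < j -> j < n -> w i e < w j e') ->
  (forall i e, i < n -> if s then w i e < z else z < w i e) ->
  (forall i, i < n -> c (w i false) z <> c (w i true) z) ->
  fib_rich c N n.
Proof.
move=> zN wN ww wz cw.
exists (fun b i => if i == n.-1 then z else w i (b i)),
  (fun _ j => if j == n.-1 then s else true); split.
- by move=> b i _ ltin; case: eqP => // _; apply: wN.
- move=> b i j _ ij ltjn; have -> : (i == n.-1) = false by lia.
  by case: eqP => [_|_]; [apply: wz; lia | apply: ww].
- move=> b b' i _ _ lin _ bi /negPf b'i; exists i, n.-1; split; try lia.
  have -> : (i == n.-1) = false by lia.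
  by rewrite eqxx bi b'i; apply/nesym/cw; lia.
Qed.

(** Position [i] holds the lower element of pair [i], unless bit [i - 1] asks for
the upper element of pair [i - 1]: with bit [i], positions [i] and [i.+1] thus
hold the two ends of one pair. *)
Lemma fib_rich_chain (w : nat -> bool -> nat) :
  (forall i e, i < n -> w i e < N) ->
  (forall i j e e', i < j -> j < n -> w i e < w j e') ->
  (forall i, i < n -> w i false < w i true) ->
  (forall i, i.+1 < n ->
     c (w i false) (w i true) <> c (w i false) (w i.+1 false)) ->
  fib_rich c N n.
Proof.
move=> wN ww w2 cw.
exists (fun b i => if i is j.+1 then if b j then w j true else w i false
                   else w 0 false), (fun _ _ => true); split.
- by move=> b [|i] _ ltin; [|case: (b i)]; apply: wN; lia.
- move=> b [|i] [|j] sb ij ltjn; [by [] | | by [] |].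
    by case: (b j); case: j {ij} ltjn => [|j] ltjn; auto; apply: ww; lia.
  case: (b i); case: (b j); try (apply: ww; lia).
  by have [->|ij'] := eqVneq j i.+1; [apply: w2; lia | apply: ww; lia].
- move=> b b' i sb sb' lin bb' bi /negPf b'i; exists i, i.+1; split; try lia.
  rewrite bi b'i; case: i => [|i] in lin bb' bi b'i *; first exact: cw.
  rewrite -bb' //; have /negPf : ~~ b i by have := sb i; rewrite bi andbT.
  by move->; apply: cw.
Qed.

(** Even positions hold elements [u], odd positions elements [z], both with an
index [idx b i] increasing along the positions of equal parity.  As the [u] lie
all on the same side of the [z], the order of the selection does not depend on
[b], whatever happens to the indices of neighbouring positions. *)
Lemma fib_rich_bipartite (u z : nat -> nat) (idx : (nat -> bool) -> nat -> nat)
    (s r : bool) :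
  (forall i, i < n.+1 -> u i < N) -> (forall i, i < n.+1 -> z i < N) ->
  (forall i j, i < j -> j < n.+1 -> u i < u j) ->
  (forall i j, i < j -> j < n.+1 -> if r then z i < z j else z j < z i) ->
  (forall i j, i < n.+1 -> j < n.+1 -> if s then u i < z j else z j < u i) ->
  (forall b i, idx b i <= i.+1) ->
  (forall b i, sparse b -> idx b i < idx b i.+2) ->
  (forall b b' i, sparse b -> sparse b' -> i.+1 < n ->
     (forall j, j < i -> b j = b' j) -> b i -> ~~ b' i ->
     c (u (idx b i)) (z (idx b i.+1)) <> c (u (idx b' i)) (z (idx b' i.+1)) /\
     c (u (idx b i.+1)) (z (idx b i)) <> c (u (idx b' i.+1)) (z (idx b' i))) ->
  fib_rich c N n.
Proof.
move=> uN zN uu zz uz idx1 idx2 cuz.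
have idxm b i j : sparse b -> i < j -> odd i = odd j -> idx b i < idx b j.
  move=> sb ij oij; have [k ->] : exists k, j = i + 2 * k.+1.
    exists (j./2 - i./2).-1.
    have := odd_double_half i; have := odd_double_half j; rewrite oij -!mul2n.
    lia.
  elim: k => [|k IH]; first by rewrite addn2; exact: idx2.
  apply: ltn_trans IH _.
  have -> : i + 2 * k.+2 = (i + 2 * k.+1).+2 by lia.
  exact: idx2.
exists (fun b i => if odd i then z (idx b i) else u (idx b i)),
  (fun i j => if odd i then if odd j then r else ~~ s else if odd j then s else true).
split.
- by move=> b i _ ltin; have := idx1 b i; case: (odd i) => ?; [apply: zN|apply: uN]; lia.
- move=> b i j sb ij ltjn; have := idx1 b i; have := idx1 b j; have := idxm b i j sb ij.
  have [oi|oi] := boolP (odd i); have [oj|oj] := boolP (odd j) => h1 h2 h3.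
  + by apply: zz => //; try lia; apply: h1.
  + by have := uz (idx b j) (idx b i); case: (s) => /=; apply; lia.
  + by apply: uz; lia.
  + by apply: uu; try lia; apply: h1.
- move=> b b' i sb sb' lin bb' bi b'i.
  have [h1 h2] := cuz b b' i sb sb' lin bb' bi b'i.
  have [oi|oi] := boolP (odd i).
    by exists i.+1, i; split; rewrite /= ?oi //; lia.
  by exists i, i.+1; split; rewrite /= ?(negPf oi) //; lia.
Qed.

End Configurations.

Section PairConfigurations.

Variables (T : Type) (c : nat -> nat -> T) (N n : nat).
Hypothesis csym : forall x y x' y', c x y = c x' y' -> c y x = c y' x'.

Definition prev (b : nat -> bool) i := if i is j.+1 then b j else false.

Section Bipartite.
Variables (u z : nat -> nat) (s r : bool).
Hypotheses (uN : forall i, i < n.+1 -> u i < N)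
  (zN : forall i, i < n.+1 -> z i < N)
  (uu : forall i j, i < j -> j < n.+1 -> u i < u j)
  (zz : forall i j, i < j -> j < n.+1 -> if r then z i < z j else z j < z i)
  (uz : forall i j, i < n.+1 -> j < n.+1 -> if s then u i < z j else z j < u i).

(** Bit [i] gives positions [i] and [i.+1] the same index. *)
Lemma fib_rich_matching :
  (forall i, i < n -> c (u i) (z i) <> c (u i) (z i.+1)) ->
  (forall i, i < n -> c (u i) (z i) <> c (u i.+1) (z i)) ->
  fib_rich c N n.
Proof.
move=> c1 c2.
apply: (fib_rich_bipartite (u := u) (z := z) (s := s) (r := r)
          (idx := fun b i => i - prev b i)) => //.
- by move=> b [|i] /=; lia.
- by move=> b [|i] _ /=; lia.
- move=> b b' i sb _ lin bb' bi /negPf b'i.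
  have -> : prev b i = false.
    by case: i bi {lin bb' b'i} => //= i bi; have := sb i; rewrite bi andbT => /negPf.
  have -> : prev b' i = false.
    case: i bi bb' {lin b'i} => //= i bi <- //.
    by have := sb i; rewrite bi andbT => /negPf.
  by rewrite /= bi b'i !subn0 subn1; split; [apply: c1 | apply: c2]; lia.
Qed.

(** Bit [i] exchanges the indices [i] and [i.+1]; the color between [u] and [z]
tells which of the two has the smaller index. *)
Lemma fib_rich_half_graph :
  (forall i j i' j', i < j -> j < n.+1 -> i' < j' -> j' < n.+1 ->
     c (u i) (z j) <> c (u j') (z i')) ->
  fib_rich c N n.
Proof.
move=> c1.
apply: (fib_rich_bipartite (u := u) (z := z) (s := s) (r := r)
          (idx := fun b i => if b i then i.+1 else i - prev b i)) => //.
- by move=> b i; case: (b i) => //; lia.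
- move=> b i sb /=; have := sb i; case: (b i) => /= [/negPf->|_].
    by case: (b i.+2); lia.
  by case: (b i.+2); lia.
- move=> b b' i sb _ lin bb' bi /negPf b'i.
  have /negPf bi1 : ~~ b i.+1 by have := sb i; rewrite bi.
  have -> : prev b' i = false.
    case: i bi bb' {lin bi1 b'i} => //= i bi <- //.
    by have := sb i; rewrite bi andbT => /negPf.
  rewrite /= bi b'i bi1 !subn0 subn1 /=.
  by split; [apply: nesym |]; apply: c1; case: (b' i.+1); lia.
Qed.
End Bipartite.

(** If [v 0] does not distinguish the later [v] from the later [w], the pairs
[(v i, w i)] form a chain; otherwise [v 0] is a probe. *)
Lemma fib_rich_interleaved (v w : nat -> nat) :
  (forall i, i < n.+1 -> v i < N) -> (forall i, i < n.+1 -> w i < N) ->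
  (forall i j, i < j -> j < n.+1 ->
    [/\ v i < v j, v i < w j, w i < v j & w i < w j]) ->
  (forall i, i < n.+1 -> v i < w i) ->
  (forall i j i' j', i < j -> j < n.+1 -> i' < j' -> j' < n.+1 ->
     c (v i) (v j) = c (v i') (v j') /\ c (v i) (w j) = c (v i') (w j')) ->
  (forall i, i < n -> c (v i) (w i) <> c (v i) (w i.+1)) ->
  fib_rich c N n.
Proof.
move=> vN wN vw vlw hom cvw.
have [n_small|n_gt0] := posnP n; first by exists (fun _ => id), (fun _ _ => true); split; lia.
have [evw|nvw] := pselect (c (v 0) (v 1) = c (v 0) (w 1)).
  apply: (fib_rich_chain (w := fun i e => if e then w i else v i)).
  - by move=> i [] lin; [apply: wN | apply: vN]; lia.
  - by move=> i j e e' ij jn; have [] := vw i j ij; [lia | case: e e' => -[]].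
  - by move=> i lin; apply: vlw; lia.
  - move=> i lin; have [|||| hv hw] := hom i i.+1 0 1; try lia.
    by rewrite hv evw -hw; apply: cvw; lia.
apply: (fib_rich_star (w := fun i e => if e then w i.+1 else v i.+1) (z := v 0) (s := false)).
- exact: vN.
- by move=> i [] lin; [apply: wN | apply: vN]; lia.
- by move=> i j e e' ij jn; have [] := vw i.+1 j.+1 ij; [lia | case: e e' => -[]].
- by move=> i e lin; have [] := vw 0 i.+1 isT; [lia | case: e].
- move=> i lin /csym; have [|||| hv hw] := hom 0 i.+1 0 1; try lia.
  by rewrite hv hw.
Qed.

End PairConfigurations.

(** * Homogeneous families of breaks and witnesses *)

Section Homogeneous.

Variables (T : eqType) (c : nat -> nat -> T) (N n : nat).
Hypothesis csym : forall x y x' y', c x y = c x' y' -> c y x = c y' x'.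

(** The labels of the elements of a triple: [Some e] for [x i + e], that is
[x i] or its successor, and [None] for the witness. *)
Definition triple (x z : nat -> nat) (i : nat) (a : option bool) : nat :=
  if a is Some e then x i + e else z i.

Variables x z : nat -> nat.
Let p := triple x z.
Let K := n.+3.
Hypotheses (xlt : forall i j, i < j -> j < K -> x i < x j)
  (xN : forall i, i < K -> (x i).+1 < N) (zN : forall i, i < K -> z i < N).
Hypothesis hom : forall i j i' j' a b, i < j -> j < K -> i' < j' -> j' < K ->
  [/\ c (p i a) (p j b) = c (p i' a) (p j' b),
      (p i a < p j b) = (p i' a < p j' b) &
      (p j b < p i a) = (p j' b < p i' a)].
Hypothesis hom1 : forall i i' a b, i < K -> i' < K ->
  c (p i a) (p i b) = c (p i' a) (p i' b) /\
  (p i a < p i b) = (p i' a < p i' b).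

(* If the pair at [x i] met the pair at [x j], then by homogeneity the successor
   of [x 0] would reach not only [x 1] but also [x 2]. *)
Let x_gap i j : i < j -> j < K -> (x i).+1 < x j.
Proof.
move=> ij jK; have h01 := xlt (ltnSn 0) (ltn0Sn n.+1 : 1 < K).
have h12 := @xlt 1 2 isT isT.
have [_ e1 _] := @hom i j 0 1 (Some true) (Some false) ij jK isT isT.
have [_ e2 _] := @hom i j 0 2 (Some true) (Some false) ij jK isT isT.
by move: e1 e2; rewrite /p /= !addn0 !addn1 => -> ; lia.
Qed.

Let p_lt i j (e e' : bool) : i < j -> j < K -> x i + e < x j + e'.
Proof. by move=> ij /(x_gap ij); case: e; case: e'; lia. Qed.

Let p_lt_N i (e : bool) : i < K -> x i + e < N.
Proof. by move/xN; case: e; lia. Qed.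

Lemma homogeneous_fib_rich_diagonal :
  c (x 0) (x 0) <> c (x 0).+1 (x 0).+1 -> fib_rich c N n.
Proof.
move=> h; apply: (fib_rich_diagonal (x := x)).
- by move=> i lin; apply: xN; rewrite /K; lia.
- by move=> i j ij jn; apply: x_gap; rewrite /K; lia.
- move=> i lin.
  have [] := @hom1 i 0 (Some false) (Some false); rewrite /K //; first lia.
  have [] := @hom1 i 0 (Some true) (Some true); rewrite /K //; first lia.
  by rewrite /p /= !addn0 !addn1 => -> _ -> _.
Qed.

Hypotheses (zx : forall i, i < K -> z i != x i /\ z i != (x i).+1)
  (xz : forall i, i < K -> c (x i) (z i) <> c (x i).+1 (z i)).

(** By homogeneity all witnesses coincide, which makes a probe. *)
Lemma homogeneous_fib_rich_const : z 0 = z 1 -> fib_rich c N n.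
Proof.
move=> z01; have zc i : i < K -> z i = z 0.
  case: i => // i iK.
  have [_] := @hom 0 i.+1 0 1 None None isT iK isT isT.
  by rewrite /p /= z01 ltnn; lia.
apply: (fib_rich_star (w := fun i e => x i + (e : bool)) (z := z 0) (s := x 0 < z 0)).
- exact: zN.
- by move=> i e lin; apply: p_lt_N; rewrite /K; lia.
- by move=> i j e e' ij jn; apply: p_lt; rewrite /K //; lia.
- move=> i e lin; have iK : i < K by rewrite /K; lia.
  have [_] := @hom1 i 0 (Some false) None iK isT.
  have [] := zx iK; rewrite /p /= !addn0 zc // => + + <-.
  by case: ifP; case: e; lia.
- move=> i lin; have iK : i < K by rewrite /K; lia.
  by have := xz iK; rewrite zc // addn0 addn1.
Qed.

Hypothesis z01 : z 0 != z 1.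

Let zz i j : i < j -> j < K -> if z 0 < z 1 then z i < z j else z j < z i.
Proof.
move=> ij jK; have [_] := @hom i j 0 1 None None ij jK isT isT.
by rewrite /p /= => -> ->; move: z01; case: (ltngtP (z 0) (z 1)).
Qed.

(* A coincidence for [i <> j] would by homogeneity identify elements of two
   different pairs. *)
Let zNx i j (e : bool) : i < K -> j < K -> z i != x j + e.
Proof.
move=> iK jK; case: (ltngtP j i) => ij.
- have [_] := @hom j i 0 2 (Some e) None ij iK isT isT.
  have [_] := @hom j i 1 2 (Some e) None ij iK isT isT.
  have := @p_lt 0 1 e e isT isT; rewrite /p /=; lia.
- have [_] := @hom i j 0 1 None (Some e) ij jK isT isT.
  have [_] := @hom i j 0 2 None (Some e) ij jK isT isT.
  have := @p_lt 1 2 e e isT isT; rewrite /p /=; lia.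
- by subst j; have [] := zx iK; case: e; rewrite ?addn0 ?addn1.
Qed.

(* A witness that tells apart an earlier pair tells apart all earlier pairs, so
   the last witness is a probe. *)
Let late_star : c (x 0) (z 1) <> c (x 0).+1 (z 1) -> fib_rich c N n.
Proof.
move=> h; apply: (fib_rich_star (w := fun i e => x i + (e : bool)) (z := z n.+2)
                    (s := x 0 < z 1)).
- by apply: zN.
- by move=> i e lin; apply: p_lt_N; rewrite /K; lia.
- by move=> i j e e' ij jn; apply: p_lt; rewrite /K //; lia.
- move=> i e lin; have iK : i < n.+2 by lia.
  have [_ + _] := @hom i n.+2 0 1 (Some false) None iK (ltnSn _) isT isT.
  have := @zNx n.+2 i false (ltnSn _) (ltnW iK).
  have := @zNx n.+2 i true (ltnSn _) (ltnW iK).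
  by rewrite /p /= !addn0 addn1 => + + <-; case: ifP; case: e; lia.
- move=> i lin; have iK : i < n.+2 by lia.
  have [+ _ _] := @hom i n.+2 0 1 (Some false) None iK (ltnSn _) isT isT.
  have [+ _ _] := @hom i n.+2 0 1 (Some true) None iK (ltnSn _) isT isT.
  by rewrite /p /= !addn0 !addn1 => -> ->.
Qed.

Let early_star : c (z 0) (x 1) <> c (z 0) (x 1).+1 -> fib_rich c N n.
Proof.
move=> h; apply: (fib_rich_star (w := fun i e => x i.+1 + (e : bool)) (z := z 0)
                    (s := x 1 < z 0)).
- by apply: zN.
- by move=> i e lin; apply: p_lt_N; rewrite /K; lia.
- by move=> i j e e' ij jn; apply: p_lt; rewrite /K //; lia.
- move=> i e lin; have iK : i.+1 < K by rewrite /K; lia.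
  have [_ _] := @hom 0 i.+1 0 1 None (Some false) isT iK isT isT.
  have := @zNx 0 i.+1 false isT iK.
  have := @zNx 0 i.+1 true isT iK.
  by rewrite /p /= !addn0 addn1 => + + <-; case: ifP; case: e; lia.
- move=> i lin; have iK : i.+1 < K by rewrite /K; lia.
  have [+ _ _] := @hom 0 i.+1 0 1 None (Some false) isT iK isT isT.
  have [+ _ _] := @hom 0 i.+1 0 1 None (Some true) isT iK isT isT.
  by rewrite /p /= !addn0 !addn1 => e1 e2 /csym; rewrite e1 e2.
Qed.

(* The side of [z j] seen from pair [i] depends on the comparison of [i] and [j]
   only.  It is constant unless [x i < z j] holds exactly when [i] is smaller,
   up to the case [i = j]; then pairs and witnesses alternate. *)
Let side_cases : (forall (e : bool) i j, i < K -> j < K ->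
    if x 0 < z 1 then x i + e < z j else z j < x i + e) \/
  (forall (e : bool) i j, i < j -> j < K -> x i + e < z j /\ z i < x j + e).
Proof.
have e1 i j : i < j -> j < K -> (x i < z j) = (x 0 < z 1).
  move=> ij jK; have [_ + _] := @hom i j 0 1 (Some false) None ij jK isT isT.
  by rewrite /p /= !addn0.
have e2 i j : i < j -> j < K -> (x j < z i) = (x 1 < z 0).
  move=> ij jK; have [_ _] := @hom i j 0 1 None (Some false) ij jK isT isT.
  by rewrite /p /= !addn0.
have e3 i : i < K -> (x i < z i) = (x 1 < z 1).
  move=> iK; have [_] := @hom1 i 1 (Some false) None iK isT.
  by rewrite /p /= !addn0.
have shift (e : bool) i j : i < K -> j < K -> (x i + e < z j) = (x i < z j).
  move=> iK jK; have := @zNx j i e jK iK; have := @zNx j i false jK iK.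
  by case: e; rewrite ?addn0 ?addn1; lia.
have flip (e : bool) i j : i < K -> j < K -> (z j < x i + e) = ~~ (x i < z j).
  move=> iK jK; rewrite -(shift e) //; have := @zNx j i e jK iK; lia.
have x01 := @xlt 0 1 isT isT; have x12 := @xlt 1 2 isT isT.
have [h1|h1] := boolP (x 0 < z 1); have [h2|h2] := boolP (x 1 < z 0).
- left=> e i j iK jK; rewrite shift //.
  case: (ltngtP i j) => [ij|ij|->]; [by rewrite e1 | by rewrite e2 | rewrite e3 //].
  have := e2 1 2 isT isT; lia.
- right=> e i j ij jK; have iK := ltn_trans ij jK.
  by split; [rewrite shift // e1 | rewrite flip // e2].
- have := e1 0 2 isT isT; have := e2 1 2 isT isT; have := e1 1 2 isT isT.
  have := e2 0 2 isT isT; lia.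
- left=> e i j iK jK; rewrite flip //.
  case: (ltngtP i j) => [ij|ij|->]; [by rewrite e1 | by rewrite e2 | rewrite e3 //].
  have := e1 0 1 isT isT; lia.
Qed.

(** When no witness is a probe for other pairs, the color of [x i + e] and [z j]
for [i <> j] does not depend on [e], whereas for [i = j] it does.  So for any
given color [g], [e] can be chosen such that the color of [x i + e] and [z i] is
not [g] ([pick] below), which leaves a matching, a half graph or an interleaved
family. *)
Lemma homogeneous_fib_rich_inj : fib_rich c N n.
Proof.
have [exz|/eqP] := eqVneq (c (x 0) (z 1)) (c (x 0).+1 (z 1)); last exact: late_star.
have [ezx|/eqP] := eqVneq (c (z 0) (x 1)) (c (z 0) (x 1).+1); last exact: early_star.
have uN (e : bool) i : i < n.+1 -> x i + e < N by move=> ?; apply: p_lt_N; rewrite /K; lia.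
have zN' i : i < n.+1 -> z i < N by move=> ?; apply: zN; rewrite /K; lia.
have homuz (e : bool) i j : i < j -> j < n.+1 -> c (x i + e) (z j) = c (x 0) (z 1).
  move=> ij jn; have [|+ _ _] := @hom i j 0 1 (Some e) None ij _ isT isT.
    by rewrite /K; lia.
  by rewrite /p /= => ->; case: e; rewrite ?addn0 ?addn1.
have homzu (e : bool) i j : i < j -> j < n.+1 -> c (z i) (x j + e) = c (z 0) (x 1).
  move=> ij jn; have [|+ _ _] := @hom i j 0 1 None (Some e) ij _ isT isT.
    by rewrite /K; lia.
  by rewrite /p /= => ->; case: e; rewrite ?addn0 ?addn1.
have hom_uz_diag (e : bool) i : i < n.+1 -> c (x i + e) (z i) = c (x 0 + e) (z 0).
  by move=> iN; have [||//] := @hom1 i 0 (Some e) None; rewrite /K; lia.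
have pick g : exists e : bool, c (x 0 + e) (z 0) <> g.
  have [e0|] := eqVneq (c (x 0 + false) (z 0)) g; last by exists false; apply/eqP.
  exists true => e1; apply: (xz (ltn0Sn _)); by rewrite -addn1 e1 -e0 addn0.
case: side_cases => [uz|uz].
  (* If the colors off the diagonal agree, the diagonal makes a matching;
     otherwise they make a half graph, for either choice of [e]. *)
  have [ed|/eqP nd] := eqVneq (c (x 0) (z 1)) (c (x 1) (z 0)).
    have [e he] := pick (c (x 0) (z 1)).
    apply: (fib_rich_matching (u := fun i => x i + e) (z := z) (s := x 0 < z 1)
              (r := z 0 < z 1)) => //.
    - exact: uN.
    - by move=> i j ij jn; apply: p_lt; rewrite /K; lia.
    - by move=> i j ij jn; apply: zz; rewrite /K; lia.
    - by move=> i j ij jn; apply: uz; rewrite /K; lia.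
    - by move=> i lin; rewrite hom_uz_diag ?(homuz e i i.+1) //; lia.
    - move=> i lin; rewrite hom_uz_diag; last lia.
      have /csym -> : c (z i) (x i.+1 + e) = c (z 0) (x 1) by apply: homzu; lia.
      by rewrite -ed.
  apply: (fib_rich_half_graph (u := fun i => x i + false) (z := z) (s := x 0 < z 1)
              (r := z 0 < z 1)) => //.
  - exact: uN.
  - by move=> i j ij jn; apply: p_lt; rewrite /K; lia.
  - by move=> i j ij jn; apply: zz; rewrite /K; lia.
  - by move=> i j ij jn; apply: uz; rewrite /K; lia.
  - move=> i j i' j' ij jn ij' jn'; rewrite homuz //.
    by have /csym -> := homzu false i' j' ij' jn'.
have zz' i j : i < j -> j < K -> z i < z j.
  move=> ij jK; have [_ + _] := @hom i j 0 2 None None ij jK isT isT.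
  rewrite /p /= => ->; have [_ h01] := uz false 0 1 isT isT.
  by have [h12 _] := uz false 1 2 isT isT; apply: ltn_trans h01 h12.
have homzz i j i' j' : i < j -> j < n.+1 -> i' < j' -> j' < n.+1 ->
    c (z i) (z j) = c (z i') (z j').
  move=> ij jn ij' jn'.
  by have [||//] := @hom i j i' j' None None ij _ ij' _; rewrite /K; lia.
have homxx (e : bool) i j i' j' : i < j -> j < n.+1 -> i' < j' -> j' < n.+1 ->
    c (x i + e) (x j + e) = c (x i' + e) (x j' + e).
  move=> ij jn ij' jn'.
  by have [||//] := @hom i j i' j' (Some e) (Some e) ij _ ij' _; rewrite /K; lia.
have side i (e : bool) : i < K -> (x i + e < z i) = (x 0 < z 0).
  move=> iK; have [_] := @hom1 i 0 (Some false) None iK isT.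
  have := @zNx i i e iK iK; have := @zNx i i false iK iK.
  by rewrite /p /=; case: e; lia.
(* The lower end of each pair of the chain comes first, so [e] is chosen against
   the color between that end and the later elements of the other kind. *)
have [x0z0|z0x0] := boolP (x 0 < z 0).
  have [e he] := pick (c (x 0) (z 1)).
  apply: (fib_rich_interleaved csym (v := fun i => x i + e) (w := z)) => //.
  - exact: uN.
  - move=> i j ij jn; have jK : j < K by rewrite /K; lia.
    by have [? ?] := uz e i j ij jK; split; auto.
  - by move=> i iN; rewrite side // /K; lia.
  - by move=> i j i' j' ij jn ij' jn'; split; [apply: homxx | rewrite !homuz].
  - by move=> i lin; rewrite hom_uz_diag ?(homuz e i i.+1) //; lia.
have [e he] := pick (c (x 1) (z 0)).
apply: (fib_rich_interleaved csym (v := z) (w := fun i => x i + e)) => //.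
- exact: uN.
- move=> i j ij jn; have jK : j < K by rewrite /K; lia.
  by have [? ?] := uz e i j ij jK; split; auto.
- move=> i iN; have iK : i < K by rewrite /K; lia.
  by have := side i e iK; have := @zNx i i e iK iK; lia.
- by move=> i j i' j' ij jn ij' jn'; split; [apply: homzz | rewrite !homzu].
- move=> i lin; rewrite (homzu e i i.+1) //.
  by move/csym; rewrite hom_uz_diag //; lia.
Qed.

End Homogeneous.

(** * Breaks and blocks *)

Section Breaks.

Variables (T : eqType) (c : nat -> nat -> T) (N : nat).
Hypothesis csym : forall x y x' y', c x y = c x' y' -> c y x = c y' x'.

Definition breaks (x : nat) : bool :=
  (c x x != c x.+1 x.+1) ||
  has (fun z => [&& z != x, z != x.+1 & c x z != c x.+1 z]) (iota 0 N).

Definition block (x : nat) : nat := count breaks (iota 0 x).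

Lemma blockS x : block x.+1 = block x + breaks x.
Proof. by rewrite /block -addn1 iotaD count_cat /= addn0. Qed.

Lemma block_homo x y : x <= y -> block x <= block y.
Proof. by move=> /subnKC <-; rewrite /block iotaD count_cat leq_addr. Qed.

Lemma block_breaks x y : x < y -> block x = block y ->
  ~~ breaks x /\ block x.+1 = block y.
Proof.
move=> xy exy; have := block_homo xy; have := blockS x; rewrite exy.
by case: (breaks x) => /=; lia.
Qed.

Lemma block_loop x y : x <= y -> block x = block y -> c x x = c y y.
Proof.
move=> /subnKC <-; move: (y - x) => k; elim: k x => [|k IH] x; first by rewrite addn0.
rewrite -addSnnS => /block_breaks[]; first lia.
by rewrite negb_or negbK => /andP[/eqP-> _]; apply: IH.
Qed.

(** Going from [x] to [y] without crossing [z], only non-breaks are passed. *)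
Lemma block_outside x y z : z < N -> x <= y -> block x = block y ->
  (z < x) || (y < z) -> c x z = c y z.
Proof.
move=> zN /subnKC <-; move: (y - x) => k; elim: k x => [|k IH] x; first by rewrite addn0.
rewrite -addSnnS => /block_breaks[]; first lia.
rewrite negb_or => /andP[_ /hasPn /(_ z)]; rewrite mem_iota zN => /(_ isT) h e zxy.
move: h; rewrite !negb_and !negbK => /or3P[zx|zx|/eqP->]; last by apply: IH; lia.
  by exfalso; move: zx zxy; lia.
by exfalso; move: zx zxy; lia.
Qed.

(** Both edges can be moved, one end at a time and without the ends crossing, to
the edge between the smaller of [x], [x'] and the larger of [y], [y']. *)
Lemma block_edge x y x' y' : y < N -> y' < N -> x < y -> x' < y' ->
  block x = block x' -> block y = block y' -> c x y = c x' y'.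
Proof.
move=> yN y'N xy x'y' ex ey.
have em : block (minn x x') = block x by rewrite /minn; case: ifP.
have eM : block (maxn y y') = block y by rewrite /maxn; case: ifP.
suff main u v : minn x x' <= u -> u < v -> v <= maxn y y' ->
    block u = block x -> block v = block y -> c u v = c (minn x x') (maxn y y').
  by rewrite (main x y) ?(main x' y') //; lia.
move=> mu uv vM eu ev.
rewrite -(@block_outside (minn x x') u v) ?em //; try lia.
by apply: csym; apply: block_outside; rewrite ?eM //; lia.
Qed.

Lemma block_cmp x y x' y' : x < N -> y < N -> x' < N -> y' < N ->
  block x = block x' -> block y = block y' ->
  (x < y) = (x' < y') -> (y < x) = (y' < x') -> c x y = c x' y'.
Proof.
move=> xN yN x'N y'N ex ey; case: (ltngtP x y) => xy.
- by move=> /esym x'y' _; apply: block_edge.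
- by move=> _ /esym y'x'; apply: csym; apply: block_edge.
move=> h1 h2; have exy : x' = y' by lia.
rewrite -xy -exy; case: (leqP x x') => xx; first exact: block_loop.
by apply/esym/block_loop; rewrite // ltnW.
Qed.

End Breaks.

(** The color of a pair of breaks for Ramsey's theorem includes the internal data
of its first triple; hence the [n.+4]-th break only serves to make the internal
data of the other [n.+3] uniform. *)
Lemma fib_rich_of_breaks (T : finType) (n : nat) :
  exists M, forall (c : nat -> nat -> T) (N : nat),
    (forall x y x' y', c x y = c x' y' -> c y x = c y' x') ->
    M <= count (breaks c N) (iota 0 N.-1) -> fib_rich c N n.
Proof.
pose Q : finType := {ffun option bool * option bool -> T * bool * bool}.
have [M hM] := ramsey_pairs (Q * Q)%type n.+4.
exists M => c N csym; rewrite -size_filter => hs.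
have wit x : exists z, breaks c N x -> c x x = c x.+1 x.+1 ->
    [/\ z < N, z != x, z != x.+1 & c x z <> c x.+1 z].
  have [/hasP[z]|h] := boolP (has (fun z =>
      [&& z != x, z != x.+1 & c x z != c x.+1 z]) (iota 0 N)).
    by rewrite mem_iota => zN /and3P[? ? /eqP ?]; exists z.
  by exists 0; rewrite /breaks (negPf h) orbF => /eqP.
have [z hz] := boolp.choice wit.
pose F x x' : Q := [ffun ab =>
  let a := triple id z x ab.1 in let b := triple id z x' ab.2 in
  (c a b, a < b, b < a)].
have [q [L [sL zL pL]]] := hM _ (fun x y => (F x y, F x x)) _ hs.
have bL i : i < n.+4 -> breaks c N (nth 0 L i) && (nth 0 L i < N.-1).
  rewrite -zL => /(mem_nth 0)/(mem_subseq sL).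
  by rewrite mem_filter mem_iota.
have lL i j : i < j -> j < n.+4 -> nth 0 L i < nth 0 L j.
  rewrite -zL => ij jL; apply: (sorted_ltn_nth ltn_trans) => //.
    apply: subseq_sorted sL _; first exact: ltn_trans.
    by apply: sorted_filter; [exact: ltn_trans | exact: iota_ltn_sorted].
  by rewrite inE (ltn_trans ij).
have hom i j : i < j -> j < n.+4 ->
    F (nth 0 L i) (nth 0 L j) = q.1 /\ F (nth 0 L i) (nth 0 L i) = q.2.
  rewrite -zL => ij jL; have iL := ltn_trans ij jL.
  by have /pairwiseP-/(_ 0 i j iL jL ij)/eqP <- := pL.
pose x i := nth 0 L i.
pose p := triple x (z \o x).
have x_hom i j i' j' a b : i < j -> j < n.+3 -> i' < j' -> j' < n.+3 ->
    [/\ c (p i a) (p j b) = c (p i' a) (p j' b),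
        (p i a < p j b) = (p i' a < p j' b) &
        (p j b < p i a) = (p j' b < p i' a)].
  move=> ij jn ij' jn'; have [e _] := hom i j ij (ltnW jn).
  have [e' _] := hom i' j' ij' (ltnW jn').
  have := congr1 (fun f : Q => f (a, b)) (etrans e (esym e')).
  by rewrite !ffunE => -[].
have x_hom1 i i' a b : i < n.+3 -> i' < n.+3 ->
    c (p i a) (p i b) = c (p i' a) (p i' b) /\
    (p i a < p i b) = (p i' a < p i' b).
  move=> iN iN'; have [_ e] := hom i n.+3 iN (ltnSn _).
  have [_ e'] := hom i' n.+3 iN' (ltnSn _).
  have := congr1 (fun f : Q => f (a, b)) (etrans e (esym e')).
  by rewrite !ffunE => -[].
have xlt i j : i < j -> j < n.+3 -> x i < x j by move=> ij jn; apply: lL; lia.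
have xN i : i < n.+3 -> (x i).+1 < N.
  by move=> iN; have /andP[_] := bL i (ltnW iN); rewrite -/(x i); lia.
have [exx|/eqP nxx] := eqVneq (c (x 0) (x 0)) (c (x 0).+1 (x 0).+1); last first.
  exact: (homogeneous_fib_rich_diagonal xlt xN x_hom x_hom1).
have zP i : i < n.+3 ->
    [/\ z (x i) < N, z (x i) != x i, z (x i) != (x i).+1
      & c (x i) (z (x i)) <> c (x i).+1 (z (x i))].
  move=> iN; apply: hz; first by have /andP[] := bL i (ltnW iN).
  have [+ _] := x_hom1 i 0 (Some false) (Some false) iN isT.
  have [+ _] := x_hom1 i 0 (Some true) (Some true) iN isT.
  by rewrite /= !addn0 !addn1 => -> ->.
have zN i : i < n.+3 -> (z \o x) i < N by case/zP.
have zx i : i < n.+3 -> (z \o x) i != x i /\ (z \o x) i != (x i).+1 by case/zP.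
have xz i : i < n.+3 -> c (x i) ((z \o x) i) <> c (x i).+1 ((z \o x) i) by case/zP.
have [e01|n01] := eqVneq ((z \o x) 0) ((z \o x) 1).
  exact: (homogeneous_fib_rich_const xlt xN zN x_hom x_hom1 zx xz e01).
exact: (homogeneous_fib_rich_inj csym xlt xN zN x_hom x_hom1 zx xz n01).
Qed.

(** * Counting Fibonacci words *)

Fixpoint sparse_words (m : nat) : seq bitseq :=
  match m with
  | 0 => [:: [::]]
  | m1.+1 => match m1 with
    | 0 => [:: [:: false]; [:: true]]
    | m2.+1 => map (cons false) (sparse_words m1) ++
               map (fun w => [:: true, false & w]) (sparse_words m2)
    end
  end.

Lemma sparse_wordsSS m : sparse_words m.+2 =
  map (cons false) (sparse_words m.+1) ++
  map (fun w => [:: true, false & w]) (sparse_words m).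
Proof. by []. Qed.

Lemma size_sparse_words m : size (sparse_words m) = fib m.+1.
Proof.
have [k] := ubnP m; elim: k m => // k IH [|[|m]] // mk.
by rewrite sparse_wordsSS size_cat !size_map !IH //; lia.
Qed.

Lemma sparse_words_uniq m : uniq (sparse_words m).
Proof.
have [k] := ubnP m; elim: k m => // k IH [|[|m]] // mk.
have inj1 : injective (cons false) by move=> ? ? [].
have inj2 : injective (fun w => [:: true, false & w]) by move=> ? ? [].
rewrite sparse_wordsSS cat_uniq !map_inj_uniq // !IH; try lia.
rewrite andbT /=; apply/hasPn => _ /mapP[w _ ->].
by apply/mapP => -[].
Qed.

Lemma sparse_wordsP m w : w \in sparse_words m -> size w = m /\ sparse (nth false w).
Proof.
have [k] := ubnP m; elim: k m w => // k IH [|[|m]] w mk.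
- by rewrite inE => /eqP->; split=> // i; rewrite !nth_nil.
- by rewrite !inE => /orP[]/eqP->; split=> // -[|[|]].
rewrite sparse_wordsSS mem_cat => /orP[]/mapP[v /IH[]]; try lia.
  by move=> sv hv ->; split=> /=; [rewrite sv | case].
by move=> sv hv ->; split=> /=; [rewrite sv | case=> [|[|i]] //=; apply: hv].
Qed.

(** * Isomorphism classes of ordered structures *)

Section Structures.
Variable k : nat.

Definition pair_type (V : finType) (R : obstruct k V) (x y : V) :
  {ffun 'I_k -> bool * bool} := [ffun i => (orho R i x y, orho R i y x)].

Lemma pair_type_orho (V W : finType) (R : obstruct k V) (S : obstruct k W) x y x' y' :
  pair_type R x y = pair_type S x' y' -> forall i, orho R i x y = orho S i x' y'.
Proof. by move=> e i; have := congr1 (fun f : {ffun _} => f i) e; rewrite !ffunE => -[]. Qed.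

Definition rank_enum (V : finType) (R : obstruct k V) (N : nat) (s : 'I_N -> V) : Prop :=
  bijective s /\ forall i j : 'I_N, ole R (s i) (s j) = (i <= j).

Lemma rank_enum_exists (V : finType) (R : obstruct k V) (N : nat) :
  #|V| = N -> exists s : 'I_N -> V, rank_enum R s.
Proof.
move=> <-{N}; have [le_refl le_anti le_trans le_total] := ole_linear R.
have sz : size (sort (ole R) (enum V)) == #|V| by rewrite size_sort cardE.
pose e := Tuple sz; exists (tnth e).
have inj_e : injective (tnth e).
  by apply/injectiveP; rewrite /injectiveb /dinjectiveb map_tnth_enum sort_uniq enum_uniq.
split; first by apply: inj_card_bij; rewrite // card_ord.
have mono (i j : 'I_#|V|) : i <= j -> ole R (tnth e i) (tnth e j).
  move=> ij; have x0 := tnth e i; rewrite !(tnth_nth x0) /=.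
  apply: (sorted_leq_nth le_trans le_refl) ; rewrite ?inE ?(eqP sz) //.
  exact: sort_sorted.
move=> i j; have [|ji] := leqP i j; first exact: mono.
apply/negP => h; have := mono _ _ (ltnW ji); move=> h'.
have /inj_e eij : tnth e i = tnth e j by apply: le_anti; rewrite h.
by rewrite eij ltnn in ji.
Qed.

Lemma isomorphic_rank_enum (V W : finType) (R : obstruct k V) (S : obstruct k W)
    N (s : 'I_N -> V) (t : 'I_N -> W) :
  rank_enum R s -> rank_enum S t ->
  (forall i j, pair_type R (s i) (s j) = pair_type S (t i) (t j)) ->
  isomorphic R S.
Proof.
move=> [[s' sK s'K] les] [bt let_] est; exists (t \o s'); split.
- by apply: bij_comp => //; exists s.
- by move=> x y /=; rewrite let_ -les !s'K.
- move=> i x y /=; rewrite -{2}[x]s'K -{2}[y]s'K.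
  exact/esym/pair_type_orho/est.
Qed.

Lemma isomorphic_refl (V : finType) (R : obstruct k V) : isomorphic R R.
Proof. by exists id; split=> //; exists id. Qed.

Lemma isomorphic_sym (V W : finType) (R : obstruct k V) (S : obstruct k W) :
  isomorphic R S -> isomorphic S R.
Proof.
move=> [f [[g fK gK] h1 h2]]; exists g; split; first by exists f.
  by move=> x y; rewrite -h1 !gK.
by move=> i x y; rewrite -h2 !gK.
Qed.

Lemma isomorphic_trans (V W X : finType) (R : obstruct k V) (S : obstruct k W)
    (Q : obstruct k X) : isomorphic R S -> isomorphic S Q -> isomorphic R Q.
Proof.
move=> [f [bf f1 f2]] [g [bg g1 g2]]; exists (g \o f); split.
- exact: bij_comp.
- by move=> x y /=; rewrite g1 f1.
- by move=> i x y /=; rewrite g2 f2.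
Qed.

(** An automorphism preserves the number of elements below, which determines an
element. *)
Lemma order_automorphism_id (V : finType) (R : obstruct k V) (f : V -> V) :
  bijective f -> (forall x y, ole R (f x) (f y) = ole R x y) -> f =1 id.
Proof.
move=> bf fle x; have [le_refl le_anti le_trans le_total] := ole_linear R.
pose rk v := #|[set u | ole R u v]|.
have rk_lt u v : ole R u v -> u != v -> rk u < rk v.
  move=> uv nuv; apply: proper_card; apply/properP; split.
    by apply/subsetP => w; rewrite !inE => /le_trans; apply.
  exists v; rewrite !inE ?le_refl //; apply: contra nuv => vu.
  by apply/eqP/le_anti; rewrite uv.
have rkf : rk (f x) = rk x.
  rewrite /rk -(on_card_preimset (onW_bij _ bf)); congr #|pred_of_set _|.
  by apply/setP => u; rewrite !inE fle.
apply/eqP; apply: contraT => nfx.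
have /orP[h|h] := le_total (f x) x; have := rk_lt _ _ h;
  by rewrite rkf ltnn ?nfx 1?eq_sym ?nfx => /(_ isT).
Qed.

Lemma pullback_exists (V W : finType) (R : obstruct k V) (g : W -> V) :
  injective g -> exists S : obstruct k W,
    [/\ forall x y, ole S x y = ole R (g x) (g y),
        forall i x y, orho S i x y = orho R i (g x) (g y) & embeds S R].
Proof.
move=> inj_g.
pose rels : {set W * W} * {ffun 'I_k -> {set W * W}} :=
  ([set p | ole R (g p.1) (g p.2)], [ffun i => [set p | orho R i (g p.1) (g p.2)]]).
have rels_lin : `[< linear_order (fun x y : W => (x, y) \in rels.1) >].
  have [le_refl le_anti le_trans le_total] := ole_linear R.
  apply/asboolP; split.
  - by move=> x; rewrite inE.
  - by move=> x y; rewrite !inE => /le_anti/inj_g.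
  - by move=> y x z; rewrite !inE; apply: le_trans.
  - by move=> x y; rewrite !inE; apply: le_total.
exists (OBStruct rels_lin).
have h1 x y : ole (OBStruct rels_lin) x y = ole R (g x) (g y) by rewrite /ole inE.
have h2 i x y : orho (OBStruct rels_lin) i x y = orho R i (g x) (g y).
  by rewrite /orho ffunE inE.
split=> //; exists (g @: [set: W]).
have gin x : g x \in g @: [set: W] by apply: imset_f; rewrite inE.
exists (fun x => exist _ (g x) (gin x)); split.
- apply: inj_card_bij; first by move=> x y [/inj_g].
  by rewrite card_sig card_imset // cardsT.
- by move=> x y; rewrite h1 /ole inE.
- by move=> i x y; rewrite h2 /orho ffunE inE.
Qed.

Lemma profile_ge (C : obclass k) (n : nat) (W : finType) (S : W -> obstruct k 'I_n) :
  (forall w, C _ (S w)) -> (forall w w', isomorphic (S w) (S w') -> w = w') ->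
  #|W| <= profile C n.
Proof.
move=> CS iS; set D := [set R : obstruct k 'I_n | `[< C _ R >]].
pose cls w := [set R in D | `[< isomorphic (S w) R >]].
have inj_cls : injective cls.
  move=> w w' /setP/(_ (S w')); rewrite !inE.
  have -> : `[< isomorphic (S w') (S w') >] by apply/asboolP/isomorphic_refl.
  have -> : `[< C _ (S w') >] by apply/asboolP.
  by move/asboolP/iS.
rewrite -cardsT -(card_imset _ inj_cls); apply: subset_leq_card.
apply/subsetP => _ /imsetP[w _ ->]; apply/imsetP; exists (S w) => //.
by rewrite inE; apply/asboolP.
Qed.

Lemma card_imset_factor (aT rT cT : finType) (D : {set aT}) (g : aT -> {set rT})
    (f : aT -> cT) :
  {in D &, forall x y, f x = f y -> g x = g y} -> #|g @: D| <= #|f @: D|.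
Proof.
move=> fg.
pose h a := if [pick x in D | f x == a] is Some x then g x else set0.
suff -> : g @: D = h @: (f @: D) by apply: leq_imset_card.
rewrite -imset_comp; apply: eq_in_imset => x xD /=; rewrite /h.
case: pickP => [y /andP[yD /eqP /esym e]|/(_ x)]; first exact: fg.
by rewrite xD eqxx.
Qed.

Lemma profile_le (C : obclass k) (n : nat) (cT : finType) (code : obstruct k 'I_n -> cT) :
  (forall R S, C _ R -> C _ S -> code R = code S -> isomorphic R S) ->
  profile C n <= #|cT|.
Proof.
move=> codeP; rewrite /profile /equivalence_partition.
set D := [set _ | _].
apply: leq_trans (card_imset_factor (f := code) _) (max_card _).
move=> R S; rewrite !inE => /asboolP CR /asboolP CS /codeP RS.
apply/setP => Q; rewrite !inE; congr (_ && _); apply/asboolP/asboolP => h.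
  exact: isomorphic_trans (isomorphic_sym (RS _ _)) h.
exact: isomorphic_trans (RS _ _) h.
Qed.

End Structures.

(** * Structures as colorings of their ranks *)

Section Coloring.
Variable k : nat.
Local Notation color := {ffun 'I_k -> bool * bool}.

(** Outside the range of the ranks the value is fixed by the exchange of the two
components, so that [rank_coloring_sym] holds without side conditions. *)
Definition rank_coloring (V : finType) (R : obstruct k V) N (s : 'I_N -> V)
    (x y : nat) : color :=
  if insub x is Some i then
    if insub y is Some j then pair_type R (s i) (s j) else [ffun => (false, false)]
  else [ffun => (false, false)].

Lemma rank_coloring_ord (V : finType) (R : obstruct k V) N (s : 'I_N -> V) (i j : 'I_N) :
  rank_coloring R s i j = pair_type R (s i) (s j).
Proof. by rewrite /rank_coloring !valK. Qed.

Lemma rank_coloring_sym (V : finType) (R : obstruct k V) N (s : 'I_N -> V) x y x' y' :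
  rank_coloring R s x y = rank_coloring R s x' y' ->
  rank_coloring R s y x = rank_coloring R s y' x'.
Proof.
pose swap (f : color) : color := [ffun i => ((f i).2, (f i).1)].
have swapE u v : rank_coloring R s v u = swap (rank_coloring R s u v).
  rewrite /rank_coloring; case: insubP => [i _ _|_]; case: insubP => [j _ _|_] /=;
  by apply/ffunP => a; rewrite !ffunE.
by move=> e; rewrite swapE e -swapE.
Qed.

(** The selections given by two words have the same order type, so by rigidity an
isomorphism between them is the identity on positions, and the colors at the
first difference of the words contradict it. *)
Lemma fib_le_profile (C : obclass k) (V : finType) (R : obstruct k V) N n (s : 'I_N -> V) :
  hereditary C -> C V R -> rank_enum R s -> fib_rich (rank_coloring R s) N n ->
  fib n <= profile C n.
Proof.
move=> hC CR [bs les] [t [sigma [tN tlt tdiff]]].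
have inj_s := bij_inj bs.
pose W : finType := seq_sub (sparse_words n.-1).
have <- : #|W| = fib n.
  by rewrite card_seq_sub ?sparse_words_uniq // size_sparse_words; case: (n).
pose b (w : W) := nth false (val w).
have sb w : sparse (b w) by have [] := sparse_wordsP (valP w).
have t_inj w (i j : 'I_n) : t (b w) i = t (b w) j -> i = j.
  move=> e; apply/val_inj; case: (ltngtP i j) => // ij.
    by have := tlt _ _ _ (sb w) ij (ltn_ord j); rewrite e !ltnn; case: ifP.
  by have := tlt _ _ _ (sb w) ij (ltn_ord i); rewrite e !ltnn; case: ifP.
pose g w (i : 'I_n) := s (Ordinal (tN _ _ (sb w) (ltn_ord i))).
have g_inj w : injective (g w) by move=> i j /inj_s [] /t_inj.
have [S hS] := boolp.choice (fun w => pullback_exists R (g_inj w)).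
apply: (profile_ge (S := S)) => [w|w w' [f [bf f1 f2]]].
  by have [_ _ /(hC _ _ _ _ CR)] := hS w.
have [S1 S2 _] := hS w; have [S1' S2' _] := hS w'.
have same_order i j : ole (S w) i j = ole (S w') i j.
  rewrite S1 S1' !les /=.
  case: (ltngtP i j) => ij.
  - have := tlt _ _ _ (sb w) ij (ltn_ord j); have := tlt _ _ _ (sb w') ij (ltn_ord j).
    by case: ifP => _; lia.
  - have := tlt _ _ _ (sb w) ij (ltn_ord i); have := tlt _ _ _ (sb w') ij (ltn_ord i).
    by case: ifP => _; lia.
  - have -> : i = j by apply: ord_inj.
    by rewrite !leqnn.
have fid : f =1 id.
  by apply: (order_automorphism_id (R := S w')) => // x y; rewrite f1 same_order.
have same_col (i j : nat) : i < n -> j < n ->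
    rank_coloring R s (t (b w) i) (t (b w) j) = rank_coloring R s (t (b w') i) (t (b w') j).
  move=> iN jN.
  have col v : rank_coloring R s (t (b v) i) (t (b v) j) =
      pair_type R (g v (Ordinal iN)) (g v (Ordinal jN)).
    have gE u (h : u < n) : g v (Ordinal h) = s (Ordinal (tN _ _ (sb v) h)).
      by congr s; apply: val_inj.
    rewrite !gE.
    exact: (rank_coloring_ord R s (Ordinal (tN _ _ (sb v) iN)) (Ordinal (tN _ _ (sb v) jN))).
  rewrite !col; apply/ffunP => a; rewrite !ffunE -!S2 -!S2'.
  by rewrite -!f2 !fid.
have [sz _] := sparse_wordsP (valP w); have [sz' _] := sparse_wordsP (valP w').
have no_first_diff v v' i : i.+1 < n -> (forall j, j < i -> b v j = b v' j) ->
    b v i -> ~~ b v' i ->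
    (forall i j, i < n -> j < n ->
      rank_coloring R s (t (b v) i) (t (b v) j) = rank_coloring R s (t (b v') i) (t (b v') j)) ->
    False.
  move=> iN bb bi bi' e; have [j [j' [jn jn']]] := tdiff _ _ i (sb v) (sb v') iN bb bi bi'.
  by apply; apply: e.
apply/val_inj/(@eq_from_nth _ false); first by rewrite sz sz'.
rewrite sz => i; elim/ltn_ind: i => i IH ilt.
have bb j : j < i -> b w j = b w' j by move=> ji; apply: IH => //; apply: ltn_trans ilt.
have iN : i.+1 < n by lia.
rewrite -/(b w i) -/(b w' i).
case E: (b w i); case E': (b w' i) => //; exfalso.
  by apply: (no_first_diff w w' i); rewrite ?E ?E'.
apply: (no_first_diff w' w i); rewrite ?E ?E' //; first by move=> j /bb.
by move=> *; apply/esym/same_col.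
Qed.

Definition blocked (V : finType) (R : obstruct k V) N l (s : 'I_N -> V)
    (bl : 'I_N -> 'I_l) : Prop :=
  [/\ rank_enum R s, {homo bl : i j / i <= j} &
      forall i j i' j', bl i = bl i' -> bl j = bl j' ->
        (i < j) = (i' < j') -> (j < i) = (j' < i') ->
        pair_type R (s i) (s j) = pair_type R (s i') (s j')].

Lemma blocked_of_breaks (V : finType) (R : obstruct k V) N l (s : 'I_N -> V) :
  rank_enum R s ->
  count (breaks (rank_coloring R s) N) (iota 0 N.-1) < l ->
  exists bl : 'I_N -> 'I_l, blocked R s bl.
Proof.
move=> es hl; set c := rank_coloring R s in hl *.
have lt_l (i : 'I_N) : block c N i < l.
  apply: leq_ltn_trans hl; apply: block_homo; have := ltn_ord i; lia.
exists (fun i => Ordinal (lt_l i)); split=> //.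
  by move=> i j /= ij; apply: block_homo.
move=> i j i' j' [ei] [ej] lt1 lt2; rewrite -!rank_coloring_ord.
by apply: block_cmp => //; apply: rank_coloring_sym.
Qed.

End Coloring.

(** * Structures with boundedly many blocks *)

Section Blocked.
Variable k : nat.

Lemma rank_enum_induced_le (V : finType) (R : obstruct k V) N M (s : 'I_N -> V)
  (rs : V -> 'I_N) : rank_enum R s -> cancel s rs -> cancel rs s ->
  forall (A : {set V}) (u : 'I_M -> {x | x \in A}), rank_enum (induced R A) u ->
  forall i j : 'I_M, (rs (val (u i)) <= rs (val (u j))) = (i <= j).
Proof.
by move=> [_ les] sK rsK A u [_ leu] i j; rewrite -leu -les !rsK /ole inE.
Qed.

(** Along the increasing enumeration of a subset the block numbers are
nondecreasing, so subsets that meet each block in the same number of elements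
have the same sequence of block numbers; matching them in increasing order is an
isomorphism. *)
Lemma blocked_monomorphic (V : finType) (R : obstruct k V) N l (s : 'I_N -> V)
    (bl : 'I_N -> 'I_l) :
  blocked R s bl ->
  exists P : {set {set V}}, monomorphic_decomposition R P /\ #|P| <= l.
Proof.
move=> [[bs les] bl_homo bl_type].
case: (bs) => rs sK rsK; pose f v := bl (rs v).
exists (preim_partition f [set: V]); split; last first.
  apply: leq_trans (card_imset_factor (f := f) _) _; last first.
    by rewrite (leq_trans (max_card _)) ?card_ord.
  by move=> x y _ _ e; apply/setP => v; rewrite !inE /= e.
split; first exact: preim_partitionP.
move=> A A' AA'.
have cardAA' a : #|[pred v in A | f v == a]| = #|[pred v in A' | f v == a]|.
  have [v fv|none] := pickP (fun v => f v == a); last first.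
    by rewrite !eq_card0 // => v; rewrite inE /= none andbF.
  have memB X : #|X :&: [set y in [set: V] | f v == f y]| = #|[pred w in X | f w == a]|.
    by apply: eq_card => w; rewrite !inE (eqP fv) eq_sym.
  by rewrite -!memB; apply/AA'/imsetP; exists v.
have col (X : {set V}) M (u : 'I_M -> {x | x \in X}) : bijective u ->
    perm_eq [seq val (u i) | i <- enum 'I_M] (enum X).
  move=> [ru uK ruK]; apply: uniq_perm; rewrite ?enum_uniq //.
    by rewrite map_inj_uniq ?enum_uniq // => i j /val_inj; apply: can_inj uK i j.
  move=> v; rewrite mem_enum; apply/mapP/idP => [[i _ ->]|vX]; first exact: valP.
  by exists (ru (Sub v vX)); rewrite ?mem_enum // ruK.
have perm_f : perm_eq (map f (enum A)) (map f (enum A')).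
  apply/allP => a _ /=; rewrite !count_map.
  have cnt (X : {set V}) : count (fun v => f v == a) (enum X) = #|[pred v in X | f v == a]|.
    rewrite cardE /enum_mem -size_filter -filter_predI; congr (size _).
    by apply: eq_filter => v; rewrite /= andbC.
  by apply/eqP; rewrite -!(eq_count (a1 := fun v => f v == a)) // !cnt.
have szA : #|A| = #|A'| by rewrite !cardE -(size_map f) (perm_size perm_f) size_map.
have [u eu] := rank_enum_exists (induced R A) (etrans (card_sig _) szA).
have [u' eu'] := rank_enum_exists (induced R A') (card_sig _).
have seqs : [seq nat_of_ord (f (val (u i))) | i <- enum 'I_#|A'|] =
            [seq nat_of_ord (f (val (u' i))) | i <- enum 'I_#|A'|].
  have sorted_f (X : {set V}) (w : 'I_#|A'| -> {x | x \in X}) :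
      rank_enum (induced R X) w ->
      sorted leq [seq nat_of_ord (f (val (w i))) | i <- enum 'I_#|A'|].
    move=> ew; rewrite sorted_map.
    have := iota_sorted 0 #|A'|; rewrite -val_enum_ord sorted_map.
    apply: sub_sorted => i j /= ij; apply: bl_homo.
    by rewrite (rank_enum_induced_le (conj bs les) sK rsK ew).
  apply: (sorted_eq leq_trans anti_leq); try exact: sorted_f.
  have -> : [seq nat_of_ord (f (val (u i))) | i <- enum 'I_#|A'|] =
    map (@nat_of_ord l) (map f [seq val (u i) | i <- enum 'I_#|A'|]) by rewrite -!map_comp.
  have -> : [seq nat_of_ord (f (val (u' i))) | i <- enum 'I_#|A'|] =
    map (@nat_of_ord l) (map f [seq val (u' i) | i <- enum 'I_#|A'|]) by rewrite -!map_comp.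
  apply: perm_map; rewrite (perm_trans (perm_map f (col _ _ _ eu.1))) //.
  by rewrite perm_sym (perm_trans (perm_map f (col _ _ _ eu'.1))) // perm_sym.
have fE i : f (val (u i)) = f (val (u' i)).
  by apply/val_inj; move/eq_in_map: seqs; apply; rewrite mem_enum.
apply: (isomorphic_rank_enum eu eu') => i j.
have ind (X : {set V}) (v w : {x | x \in X}) :
    pair_type (induced R X) v w = pair_type R (val v) (val w).
  by apply/ffunP => a; rewrite !ffunE /orho !ffunE !inE.
rewrite !ind -[val (u i)]rsK -[val (u j)]rsK -[val (u' i)]rsK -[val (u' j)]rsK.
have le_u := rank_enum_induced_le (conj bs les) sK rsK eu.
have le_u' := rank_enum_induced_le (conj bs les) sK rsK eu'.
by apply: bl_type; [exact: fE | exact: fE | |]; rewrite !ltnNge le_u le_u'.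
Qed.

(** A nondecreasing map to ['I_l] is determined by its cuts, of which there are
only polynomially many. *)
Definition cuts n l (bl : 'I_n -> 'I_l) : {ffun 'I_l -> 'I_n.+1} :=
  [ffun a : 'I_l => inord #|[set i | bl i < a]|].

Lemma cutsP n l (bl : 'I_n -> 'I_l) : {homo bl : i j / i <= j} ->
  forall (i : 'I_n) a, (i < cuts bl a) = (bl i < a).
Proof.
move=> bl_homo i a; rewrite /cuts ffunE inordK; last first.
  by rewrite ltnS (leq_trans (max_card _)) ?card_ord.
have card_lt m : m <= n -> #|[set j : 'I_n | j < m]| = m.
  move=> mn; rewrite -sum1dep_card -(big_ord_widen _ (fun=> 1)) //.
  by rewrite sum1_card card_ord.
apply/idP/idP => [|lt_i_a].
  apply: contraTT; rewrite -leqNgt -[~~ (_ < #|_|)]leqNgt => le_a_i.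
  rewrite -[leqRHS]card_lt ?(ltnW (ltn_ord i)) //.
  apply/subset_leq_card/subsetP => j; rewrite !inE => lt_j_a.
  rewrite ltnNge; apply/negP => /bl_homo; rewrite leqNgt.
  by rewrite (leq_trans lt_j_a).
rewrite -[leqLHS]card_lt //; apply/subset_leq_card/subsetP => j; rewrite !inE ltnS.
by move=> /bl_homo ji; apply: leq_ltn_trans lt_i_a.
Qed.

Lemma cuts_inj n l (bl bl' : 'I_n -> 'I_l) :
  {homo bl : i j / i <= j} -> {homo bl' : i j / i <= j} ->
  cuts bl = cuts bl' -> bl =1 bl'.
Proof.
move=> h h' e i; apply/val_inj/eqP; rewrite eqn_leq; apply/andP; split.
  by rewrite leqNgt -(cutsP h') -e (cutsP h) ltnn.
by rewrite leqNgt -(cutsP h) e (cutsP h') ltnn.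
Qed.

(** A blocked structure is coded by its cuts and by the table of its colors in
terms of the two blocks and the comparison of the two ranks. *)
Lemma profile_le_blocked (C : obclass k) n l :
  (forall R : obstruct k 'I_n, C _ R ->
     exists (s : 'I_n -> 'I_n) (bl : 'I_n -> 'I_l), blocked R s bl) ->
  profile C n <=
    n.+1 ^ l * #|{ffun 'I_l * 'I_l * (bool * bool) -> {ffun 'I_k -> bool * bool}}|.
Proof.
move=> CB; pose colT : finType :=
  ({ffun 'I_l * 'I_l * (bool * bool) -> {ffun 'I_k -> bool * bool}}).
have codeP (R : obstruct k 'I_n) : exists c : {ffun 'I_l -> 'I_n.+1} * colT,
    C _ R -> exists s (bl : 'I_n -> 'I_l),
      [/\ rank_enum R s, {homo bl : i j / i <= j}, c.1 = cuts bl &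
      forall i j, pair_type R (s i) (s j) = c.2 ((bl i, bl j), (i < j, j < i))].
  have [/CB[s [bl [es hbl tbl]]]|nC] := pselect (C _ R); last first.
    by exists ([ffun=> ord0], [ffun=> [ffun=> (false, false)]]).
  pose col : colT := [ffun q => if [pick ij : 'I_n * 'I_n |
      ((bl ij.1, bl ij.2), (ij.1 < ij.2, ij.2 < ij.1)) == q] is Some ij
      then pair_type R (s ij.1) (s ij.2) else [ffun=> (false, false)]].
  exists (cuts bl, col) => _; exists s, bl; split=> // i j; rewrite ffunE.
  case: pickP => [[i' j'] /= /eqP[? ? ? ?]|/(_ (i, j))]; last by rewrite eqxx.
  exact: tbl.
have [code hcode] := boolp.choice codeP.
rewrite -[n.+1 in leqRHS]card_ord -[X in _ ^ X]card_ord -card_ffun -card_prod.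
apply: (profile_le (code := code)) => R S CR CS e.
have [s [bl [es hbl cbl tbl]]] := hcode R CR.
have [s' [bl' [es' hbl' cbl' tbl']]] := hcode S CS.
apply: (isomorphic_rank_enum es es') => i j.
by rewrite tbl tbl' e !(@cuts_inj _ _ bl bl') // -cbl -cbl' e.
Qed.

End Blocked.

Lemma polynomially_bounded_power (f : nat -> nat) l K :
  (forall n, f n <= n.+1 ^ l * K) -> polynomially_bounded f.
Proof.
move=> fle; exists ((K%:R)%:P * ('X + 1%:P) ^+ l)%R => n.
rewrite hornerM hornerC horner_exp hornerD hornerX hornerC.
by rewrite GRing.natr1 -GRing.natrX -GRing.natrM Num.Theory.ler_nat mulnC.
Qed.

Theorem theorem1p4 (k : nat) (C : obclass k) (hC : hereditary C) :
  (polynomially_bounded (profile C) /\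
   exists l : nat, forall (V : finType) (R : obstruct k V), C V R ->
     exists P : {set {set V}}, monomorphic_decomposition R P /\ #|P| <= l)
  \/ (forall n : nat, fib n <= profile C n).
Proof.
have [fib_le|/existsNP[n not_fib]] := pselect (forall n, fib n <= profile C n).
  by right.
left; have [M hM] := fib_rich_of_breaks {ffun 'I_k -> bool * bool} n.
have blk (V : finType) (R : obstruct k V) N : C V R -> #|V| = N ->
    exists (s : 'I_N -> V) (bl : 'I_N -> 'I_M), blocked R s bl.
  move=> CR cV; have [s es] := rank_enum_exists R cV; exists s.
  apply: blocked_of_breaks => //; rewrite ltnNge; apply/negP => hm.
  apply: not_fib; apply: (fib_le_profile hC CR es); apply: hM hm.
  exact: rank_coloring_sym.
split; last first.
  exists M => V R CR; have [s [bl hbl]] := blk V R _ CR erefl.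
  exact: blocked_monomorphic hbl.
apply: polynomially_bounded_power => m.
by apply: profile_le_blocked => R CR; apply: blk; rewrite ?card_ord.
Qed.
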